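(* Colocal connectedness of the domain is not necessarily preserved by a proximately refinable map; that is, there exist continua $(X,d_X)$ and $(Y,d_Y)$ and a proximately refinable map $f : X \to Y$ such that $X$ is colocally connected and $Y$ is not colocally connected.
   Context: A continuum is a nonempty compact connected metrizable space. A function need not be continuous, whereas a map is continuous. A continuum $X$ is colocally connected if for each $x \in X$ and each neighborhood $V \subseteq X$ of $x$ there exists an open neighborhood $U \subseteq X$ of $x$ such that $x \in U \subseteq V$ and $X \setminus U$ is connected (the empty set is regarded as connected). Let $(X,d_X)$ and $(Y,d_Y)$ be continua and $\varepsilon>0$. A function $g : X \to Y$ is $\varepsilon$-continuous if for each $x \in X$ there exists an open neighborhood $U \subseteq X$ of $x$ such that $g(U) \subseteq \{y \in Y \mid d_Y(g(x),y) < \varepsilon\}$. A surjective function $g : X \to Y$ is a strong $\varepsilon$-function if for each $y \in Y$ there exists an open neighborhood $V \subseteq Y$ of $y$ such that the diameter of $g^{-1}(V)$ with respect to $d_X$ is less than $\varepsilon$. Given a surjective function $f : X \to Y$, a surjective function $g : X \to Y$ is a proximate $\varepsilon$-refinement of $f$ if $g$ is $\varepsilon$-continuous, $g$ is a strong $\varepsilon$-function, and $d_Y(f(x),g(x)) < \varepsilon$ for each $x \in X$. A surjective function $p : X \to Y$ is proximately refinable if for every $\varepsilon > 0$ there exists a proximate $\varepsilon$-refinement of $p$. (Every proximately refinable function is continuous, hence a map.) *)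

(* Defs.v *)
From mathcomp Require Import all_boot all_order all_algebra.
From mathcomp Require Import boolp classical_sets functions reals ereal.
From mathcomp Require Import topology.

Set Implicit Arguments.
Unset Strict Implicit.
Unset Printing Implicit Defensive.

Import Order.TTheory GRing.Theory Num.Theory.

Local Open Scope classical_set_scope.
Local Open Scope ring_scope.

(* Metrizability is carried by the type: the topology of a [metricType R] is
   the one induced by its distance [mdist]. *)
Definition continuum (R : realType) (X : metricType R) : Prop :=
  [/\ [set: X] !=set0, compact [set: X] & connected [set: X]].

(* [connected set0] holds in the library ([connected0]). *)
Definition colocally_connected (X : topologicalType) : Prop :=
  forall (x : X) (V : set X), nbhs x V ->
    exists U : set X, [/\ open_nbhs x U, U `<=` V & connected (~` U)].

(* Extended-real valued, so that an unbounded set has diameter [+oo]. *)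
Definition diameter (R : realType) (X : metricType R) (A : set X) : \bar R :=
  ereal_sup [set (mdist p.1 p.2)%:E | p in A `*` A].

Definition eps_continuous (R : realType) (X Y : metricType R) (e : R)
    (g : X -> Y) : Prop :=
  forall x : X, exists U : set X,
    open_nbhs x U /\ g @` U `<=` [set y | mdist (g x) y < e].

Definition strong_eps_function (R : realType) (X Y : metricType R) (e : R)
    (g : X -> Y) : Prop :=
  set_surj [set: X] [set: Y] g /\
  forall y : Y, exists V : set Y,
    open_nbhs y V /\ (diameter (g @^-1` V) < e%:E)%E.

Definition proximate_refinement (R : realType) (X Y : metricType R) (e : R)
    (f g : X -> Y) : Prop :=
  [/\ set_surj [set: X] [set: Y] g, eps_continuous e g,
      strong_eps_function e g & forall x : X, mdist (f x) (g x) < e].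

Definition proximately_refinable (R : realType) (X Y : metricType R)
    (p : X -> Y) : Prop :=
  set_surj [set: X] [set: Y] p /\
  forall e : R, 0 < e -> exists g : X -> Y, proximate_refinement e p g.

(* Main.v *)
Require Import Defs.
From HB Require Import structures.
From mathcomp Require Import all_boot all_order all_algebra.
From mathcomp Require Import boolp classical_sets functions reals ereal.
From mathcomp Require Import set_interval topology normedtype trigo.
From mathcomp Require Import lra.

(** Let [f] be the projection of the square [`[0, 1] * `[-1, 1]] onto
[`[0, 1]]. The curve [t |-> (t, cos (2 pi m t))] is a section of [f] whose
image is nearly dense when [m] is large, so sending every point of the square
to the parameter of a nearby point of the curve at the same height gives a
function close to [f], with small fibres because the curve is continuous. The
square is colocally connected while interior points of the arc cut it. *)

Set Implicit Arguments.
Unset Strict Implicit.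
Unset Printing Implicit Defensive.

Import Order.TTheory GRing.Theory Num.Theory.
Import numFieldTopology.Exports numFieldNormedType.Exports.

Local Open Scope classical_set_scope.
Local Open Scope ring_scope.

(** * Metrics on subspaces and products *)

Section subtype_metric.
Context (R : realType) (M : metricType R) (A : set M).

Let dist (x y : A) : R := mdist (set_val x) (set_val y).

Let dist_ge0 (x y : A) : 0 <= dist x y.
Proof. exact: mdist_ge0. Qed.

Let dist_positivity (x y : A) : dist x y = 0 -> x = y.
Proof. by move=> /mdist_positivity /val_inj. Qed.

Let ballE (x : A) (d : R) : ball x d = [set y | dist x y < d].
Proof.
have -> : ball x d = set_val @^-1` ball (set_val x) d by [].
by rewrite ballEmdist.
Qed.

HB.instance Definition _ :=
  @PseudoMetric_isMetric.Build R (set_type A) dist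
    dist_ge0 dist_positivity ballE.

End subtype_metric.

Section product_metric.
Context (R : realType) (M N : metricType R).

(** The maximum is taken because the balls already given on the product are products of balls. *)
Let dist (x y : M * N) : R := Num.max (mdist x.1 y.1) (mdist x.2 y.2).

Let dist_ge0 (x y : M * N) : 0 <= dist x y.
Proof. by rewrite le_max mdist_ge0. Qed.

Let dist_positivity (x y : M * N) : dist x y = 0 -> x = y.
Proof.
move=> d0; have : dist x y <= 0 by rewrite d0.
rewrite ge_max => /andP[d1 d2]; apply/eqP; rewrite -pair_eqE; apply/andP.
by split; apply/eqP/(@mdist_positivity R)/eqP; rewrite eq_le mdist_ge0 ?d1 ?d2.
Qed.

Let ballE (x : M * N) (d : R) : ball x d = [set y | dist x y < d].
Proof.
apply/seteqP; split => y /=; rewrite /ball/= /prod_ball !ballEmdist/= gt_max.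
  by move=> [-> ->].
by move=> /andP.
Qed.

HB.instance Definition _ :=
  @PseudoMetric_isMetric.Build R (M * N)%type dist
    dist_ge0 dist_positivity ballE.

End product_metric.

Lemma mdist_pairE (R : realType) (M N : metricType R) (x y : M * N) :
  mdist x y = Num.max (mdist x.1 y.1) (mdist x.2 y.2).
Proof. by []. Qed.

(** * Proximate refinability of projections *)

Lemma nbhs_mdist (R : realType) (M : metricType R) (x : M) (e : R) :
  0 < e -> nbhs x [set y | mdist x y < e].
Proof. by move=> e0; rewrite -ballEmdist; exact: nbhsx_ballx. Qed.

Lemma nbhs_open_nbhs (T : topologicalType) (x : T) (A : set T) :
  nbhs x A -> exists2 U, open_nbhs x U & U `<=` A.
Proof. by rewrite nbhsE. Qed.

(** The hypothesis asks for maps [h] all of whose fibres are [e]-dense in [Y]; a refinement [k]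
    sends [(y, z)] to a point of the fibre over [z] close to [y]. The point [z0] makes [fst]
    surjective. *)
Lemma proximately_refinable_fst (R : realType) (Y Z : metricType R) (z0 : Z) :
  (forall e : R, 0 < e -> exists2 h : Y -> Z, continuous h &
    forall y z, exists2 y', h y' = z & mdist y y' < e) ->
  proximately_refinable (fst : Y * Z -> Y).
Proof.
move=> H; split; first by move=> y _; exists (y, z0).
move=> e e0; have e8 : 0 < e / 8 by lra.
have [h hc hd] := H _ e8.
(* The last clause fixes the choice on the graph of [h], which makes [k] surjective. *)
have /choice[k kP] : forall x : Y * Z, exists y, h y = x.2 /\
    mdist x.1 y < e / 8 /\ (h x.1 = x.2 -> y = x.1).
  move=> x; have [hx|hx] := pselect (h x.1 = x.2).
    by exists x.1; rewrite mdistxx.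
  by have [y hy xy] := hd x.1 x.2; exists y; split => //; split.
have ksurj : set_surj [set: Y * Z] [set: Y] k.
  by move=> y _; exists (y, h y) => //; have [_ [_ ->]] := kP (y, h y).
exists k; split => //.
(* [k] may jump, but it stays within [e / 8] of the continuous [fst]. *)
- move=> x; have /nbhs_open_nbhs[U xU UA] := nbhs_mdist x e8.
  exists U; split => //; move=> _ [x' Ux' <-] /=.
  have := UA _ Ux'; rewrite /= mdist_pairE gt_max => /andP[d1 _].
  have [_ [dx _]] := kP x; have [_ [dx' _]] := kP x'.
  have := metric_triangle (k x) x.1 (k x'); rewrite (metric_sym (k x) x.1).
  have := metric_triangle x.1 x'.1 (k x').
  by lra.
- split => // y.
  have hy := hc y _ (nbhs_mdist (h y) e8).
  have [V yV VA] := nbhs_open_nbhs (filterI (nbhs_mdist y e8) hy).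
  exists V; split => //.
  (* First coordinates are compared through [k p], [y], [k q], in four steps below [e / 8]; second
     coordinates are [h (k p)] and [h (k q)], both near [h y]. A supremum only inherits [<=], hence
     the bound [e / 2]. *)
  apply: (@le_lt_trans _ _ (e / 2)%:E); last by rewrite lte_fin; lra.
  apply: ge_ereal_sup => _ [[p q] [/= Vp Vq] <-]; rewrite lee_fin mdist_pairE.
  have [dp hp] := VA _ Vp; have [dq hq] := VA _ Vq.
  have [kp1 [kp2 _]] := kP p; have [kq1 [kq2 _]] := kP q.
  rewrite /= kp1 in hp; rewrite /= kq1 in hq; rewrite /= in dp dq.
  rewrite ge_max; apply/andP; split.
    have := metric_triangle p.1 (k p) q.1.
    have := metric_triangle (k p) y q.1.
    have := metric_triangle y (k q) q.1.
    rewrite (metric_sym (k q) q.1) (metric_sym (k p) y).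
    by lra.
  have := metric_triangle p.2 (h y) q.2; rewrite (metric_sym p.2 (h y)).
  by lra.
- by move=> x; have [_ [xk _]] := kP x; rewrite (lt_trans xk)//; lra.
Qed.

(** * Connectedness and colocal connectedness of products *)

Section product_connected.
Context (X Y : topologicalType).
Hypotheses (cX : connected [set: X]) (cY : connected [set: Y]).

Let horizontal (y : Y) : connected [set p : X * Y | p.2 = y].
Proof.
have -> : [set p : X * Y | p.2 = y] = (fun x => (x, y)) @` [set: X].
  by apply/seteqP; split => [[x ?] /= ->|_ [x _ <-]//]; exists x.
apply: connected_continuous_connected => //; apply: continuous_subspaceT => x.
by apply: cvg_pair => //; exact: cvg_cst.
Qed.

Let vertical (x : X) : connected [set p : X * Y | p.1 = x].
Proof.
have -> : [set p : X * Y | p.1 = x] = (fun y => (x, y)) @` [set: Y].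
  by apply/seteqP; split => [[? y] /= ->|_ [y _ <-]//]; exists y.
apply: connected_continuous_connected => //; apply: continuous_subspaceT => y.
by apply: cvg_pair => //; exact: cvg_cst.
Qed.

(* Every line avoiding the box meets the cross [p.1 = a \/ p.2 = b]. *)
Lemma connected_setC_setX (A : set X) (B : set Y) (a : X) (b : Y) :
  ~ A a -> ~ B b -> connected (~` (A `*` B)).
Proof.
move=> Aa Bb; pose cross := [set p : X * Y | p.1 = a] `|` [set p | p.2 = b].
have crossC : connected cross by apply: connectedU => //; exists (a, b).
(* To the cross is added a line through [p] that avoids the box: if [p.1] is in [A], then [p.2] is
   not in [B] and the horizontal line works; otherwise the vertical one does. *)
pose F (p : X * Y) := cross `|`
  if pselect (A p.1) then [set q : X * Y | q.2 = p.2] else [set q | q.1 = p.1].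
have -> : ~` (A `*` B) = \bigcup_(p in ~` (A `*` B)) F p.
  apply/seteqP; split => [p ABp|q [p ABp] Fpq [Aq Bq]].
    by exists p => //; right; case: pselect.
  case: Fpq => [[/= qa|/= qb]|].
  - by apply: Aa; rewrite -qa.
  - by apply: Bb; rewrite -qb.
  - case: pselect => [Ap /= qp|Ap /= qp].
      by apply: ABp; split => //=; rewrite -qp.
    by apply: Ap; rewrite -qp.
apply: bigcup_connected.
  by exists (a, b) => p _; left; left.
move=> p ABp; rewrite /F; case: pselect => [Ap|Ap]; apply: connectedU => //.
  by exists (a, p.2); split => //; left.
by exists (p.1, b); split => //; right.
Qed.

Lemma connected_prod (x : X) (y : Y) : connected [set: X * Y].
Proof.
by rewrite -setC0 -(set0X (@set0 Y)); apply: (@connected_setC_setX _ _ x y).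
Qed.

(** With a second point in each T1 factor, both sides of a box neighbourhood shrink to proper open
    sets, and the complement of such a box is connected. *)
Lemma colocally_connected_prod : accessible_space X -> accessible_space Y ->
  (forall x : X, exists x', x' != x) -> (forall y : Y, exists y', y' != y) ->
  colocally_connected (X * Y)%type.
Proof.
move=> aX aY nX nY [x y] V [[A B] /= [xA yB] ABV].
have proper (T : topologicalType) (t : T) (C : set T) : accessible_space T ->
    (exists t', t' != t) -> nbhs t C ->
    exists2 U, open_nbhs t U & U `<=` C /\ exists t', ~ U t'.
  move=> aT [t' t't]; rewrite nbhsE => -[U [oU Ut] UC].
  rewrite eq_sym in t't; have [W [oW /set_mem Wt /set_mem Wt']] := aT _ _ t't.
  exists (U `&` W); first by split; first exact: openI.
  split; first by move=> z [/UC].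
  by exists t' => -[_ /Wt'].
have [U [oU Ux] [UA [a Ua]]] := proper _ _ _ aX (nX x) xA.
have [W [oW Wy] [WB [b Wb]]] := proper _ _ _ aY (nY y) yB.
exists (U `*` W); split.
- split => //; rewrite openE => -[u w] [/= Uu Ww].
  by exists (U, W) => //; split => /=; apply: open_nbhs_nbhs.
- by move=> [u w] [/= Uu Ww]; apply: ABV; split; [exact: UA|exact: WB].
- exact: connected_setC_setX Ua Wb.
Qed.

End product_connected.

(** * Compactness and connectedness of subtypes *)

Section subtype_compact_connected.
Context (T : topologicalType) (A : set T) (a : A).

(** Extending the identity by the default value [a] outside [A] presents the subtype as a continuous
    image of the set [A]. *)
Let retract_continuous : {within A, continuous (valL_ a (@id A))}.
Proof. by apply/subspace_valL_continuousP' => x. Qed.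

Let retract_surj : valL_ a (@id A) @` A = [set: A].
Proof.
apply/seteqP; split => // x _; exists (set_val x); first exact: set_valP.
by have /(congr1 (@^~ x)) := valLK a (@id A).
Qed.

Lemma compact_set_type : compact A -> compact [set: A].
Proof. by move=> cA; rewrite -retract_surj; exact: continuous_compact. Qed.

Lemma connected_set_type : connected A -> connected [set: A].
Proof.
by move=> cA; rewrite -retract_surj; exact: connected_continuous_connected.
Qed.

End subtype_compact_connected.

(** * Segments as continua *)

Definition segment (R : realType) (a b : R) : set R^o := `[a, b]%classic.

Lemma mem_segment (R : realType) (a b t : R) :
  (t \in segment a b) = (a <= t <= b).
Proof.
by apply/idP/idP => [/set_mem|tab]; [|apply/mem_set]; rewrite /segment/= in_itv.
Qed.

Definition segment_point (R : realType) (a b t : R) (tab : a <= t <= b) :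
    segment a b :=
  exist (fun x => x \in segment a b) t (etrans (mem_segment a b t) tab).

Lemma mdist_segmentE (R : realType) (a b : R) (x y : segment a b) :
  mdist x y = `|(val y : R) - val x|.
Proof. by []. Qed.

Lemma continuum_segment (R : realType) (a b : R) : a <= b ->
  continuum (segment a b).
Proof.
move=> ab; have aab : a <= a <= b by rewrite lexx.
pose p := segment_point aab; split; first by exists p.
- exact: (compact_set_type p (@segment_compact R a b)).
- exact: (connected_set_type p (@segment_connected R a b)).
Qed.

Lemma continuum_prod (R : realType) (X Y : metricType R) :
  continuum X -> continuum Y -> continuum (X * Y)%type.
Proof.
move=> [[x _] kX cX] [[y _] kY cY]; split; first by exists (x, y).
  by rewrite -setXTT; exact: compact_setX.
exact: connected_prod.
Qed.

Lemma segment_nontrivial (R : realType) (a b : R) : a < b ->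
  forall x : segment a b, exists y, y != x.
Proof.
move=> ab x.
have aab : a <= a <= b by rewrite lexx ltW.
have bab : a <= b <= b by rewrite lexx ltW.
have [<-|xa] := eqVneq (segment_point aab) x; last first.
  by exists (segment_point aab).
by exists (segment_point bab); apply/eqP => -[/eqP]; rewrite gt_eqF.
Qed.

(** The complement of a small neighbourhood of the midpoint contains both endpoints but not the
    midpoint, so its image in the line is not an interval. *)
Lemma segment_not_colocally_connected (R : realType) (a b : R) : a < b ->
  ~ colocally_connected (segment a b).
Proof.
move=> ab cl.
have mab : a <= (a + b) / 2 <= b by apply/andP; split; lra.
have aab : a <= a <= b by rewrite lexx ltW.
have bab : a <= b <= b by rewrite lexx ltW.
pose m := segment_point mab.
(* This is the distance from the midpoint to the endpoints, so the open ball of this radius excludes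
   both. *)
have hab : 0 < (b - a) / 2 by lra.
have [U [[oU Um] UV cU]] := cl m _ (nbhs_mdist m hab).
have : connected ((set_val : segment a b -> R^o) @` ~` U).
  apply: connected_continuous_connected => //; apply: continuous_subspaceT.
  exact: initial_continuous.
have Ua : ~ U (segment_point aab).
  by move=> /UV/=; rewrite mdist_segmentE ltr_norml/= => /andP[]; lra.
have Ub : ~ U (segment_point bab).
  by move=> /UV/=; rewrite mdist_segmentE ltr_norml/= => /andP[]; lra.
move=> /connected_intervalP itvU.
have [||t nUt tm] := itvU a b _ _ ((a + b) / 2) mab.
- by exists (segment_point aab).
- by exists (segment_point bab).
- by apply: nUt; have -> : t = m by exact: val_inj.
Qed.

(** * An oscillating map with nearly dense fibres *)

(** A cosine of period [1 / m.+1 < e] takes every value of [[-1, 1]] on each of the [m.+1] periods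
    that divide [[0, 1]]. *)
Lemma cos_section (R : realType) (e : R) : 0 < e ->
  exists2 h : segment (0 : R) 1 -> segment (-1 : R) 1,
    continuous h & forall y z, exists2 y', h y' = z & mdist y y' < e.
Proof.
move=> e0.
have [m me] : exists m : nat, e^-1 < m.+1%:R.
  have /truncn_itv/andP[_ me] : 0 <= e^-1 by rewrite invr_ge0 ltW.
  by exists (Num.truncn e^-1).
have cosI (t : R) : -1 <= cos t <= 1 by rewrite cos_geN1 cos_le1.
pose h (t : segment (0 : R) 1) : segment (-1 : R) 1 :=
  segment_point (cosI (set_val t * m.+1%:R * (pi *+ 2))).
exists h.
  apply: continuous_comp_initial.
  have -> : set_val \o h =
    cos \o (fun t => (set_val t : R) * m.+1%:R * (pi *+ 2)) by [].
  have vc : continuous (set_val : segment (0 : R) 1 -> R^o).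
    exact: initial_continuous.
  move=> t; apply: continuous_comp; last exact: continuous_cos.
  exact: (cvgM (cvgM (vc t) (cvg_cst _)) (cvg_cst _)).
move=> y z.
have := set_valP y; rewrite -in_setE mem_segment => /andP[y0 y1].
have := set_valP z; rewrite -in_setE mem_segment => z1.
(* [k] numbers a period containing [y]. At [y = 1] truncation would give [m.+1], whose period leaves
   [[0, 1]]; there [m] is taken, hence the non-strict upper bound. *)
have [k km [ky yk]] : exists2 k : nat, (k <= m)%N &
    k%:R <= (val y : R) * m.+1%:R /\ (val y : R) * m.+1%:R <= k%:R + 1.
  have /truncn_itv/andP[ky yk] : 0 <= (val y : R) * m.+1%:R by rewrite mulr_ge0.
  have [km|mk] := leqP (Num.truncn ((val y : R) * m.+1%:R)) m.
    by exists (Num.truncn ((val y : R) * m.+1%:R)); rewrite // natr1 (ltW yk).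
  exists m => //; split; last by rewrite natr1 ler_piMl.
  by rewrite (le_trans _ ky)// ler_nat ltnW.
(* [u] is the phase at which the cosine equals [z]; shifted by [k] and rescaled, it lands in the
   same closed period as [y]. *)
pose u : R := acos (val z : R) / (pi *+ 2).
have pi0 : 0 < pi *+ 2 :> R by rewrite pmulrn_lgt0 ?pi_gt0.
have u0 : 0 <= u by rewrite divr_ge0 ?acos_ge0 ?(ltW pi0).
have u1 : u <= 1.
  by rewrite ler_pdivrMr// mul1r (le_trans (acos_lepi z1))// mulr2n lerDl pi_ge0.
have m0 : 0 < m.+1%:R :> R by [].
have tI : 0 <= (u + k%:R) / m.+1%:R <= 1.
  rewrite divr_ge0 ?addr_ge0//= ler_pdivrMr// mul1r.
  by rewrite addrC -natr1 lerD ?ler_nat.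
exists (segment_point tI).
  apply: val_inj => /=.
  rewrite divfK ?gt_eqF// mulrDl divfK ?gt_eqF// mulr_natl.
  by rewrite (periodicn (@cosD2pi R)) acosK// in_itv.
rewrite mdist_segmentE; apply: (@le_lt_trans _ _ m.+1%:R^-1); last first.
  by rewrite -(invrK e) ltf_pV2 ?posrE ?invr_gt0.
have -> : val (segment_point tI) - (val y : R) =
    (u + k%:R - (val y : R) * m.+1%:R) / m.+1%:R.
  by rewrite mulrBl mulfK ?gt_eqF.
rewrite normrM [X in _ * X]ger0_norm ?invr_ge0 ?ler0n//.
rewrite ler_piMl ?invr_ge0 ?ler0n// ler_norml; apply/andP; split; lra.
Qed.

(** * The projection of a square onto an arc *)

Theorem mainTheorem3 (R : realType) :
  exists (X Y : metricType R) (f : X -> Y),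
    [/\ continuum X /\ continuum Y,
        continuous f /\ proximately_refinable f,
        colocally_connected X
      & ~ colocally_connected Y].
Proof.
pose Y : metricType R := segment (0 : R) 1.
pose Z : metricType R := segment (-1 : R) 1.
have cY : continuum Y by apply: continuum_segment; exact: ler01.
have cZ : continuum Z by apply: continuum_segment; lra.
exists (Y * Z)%type, Y, fst; split.
- by split => //; exact: continuum_prod.
- split; first by move=> x; exact: cvg_fst.
  have [[z _] _ _] := cZ; apply: (proximately_refinable_fst z).
  exact: cos_section.
- have [_ _ cY'] := cY; have [_ _ cZ'] := cZ.
  apply: colocally_connected_prod => //.
  + exact/hausdorff_accessible/metric_hausdorff.
  + exact/hausdorff_accessible/metric_hausdorff.
  + exact/segment_nontrivial/ltr01.
  + by apply: segment_nontrivial; lra.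
- exact/segment_not_colocally_connected/ltr01.
Qed.
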